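(* Let $s\geq t\geq 2$ be integers, and let $G$ be a $K_{s,t}$-free graph of order $n$ with $e(G)$ edges. Then $$e(G)\leq \frac12 (s-t+1)^{1/t}n^{2-1/t}+\frac12 (t-1)n^{2-2/t}+\frac12 (t-2)n.$$
   Context: Graphs are finite, simple and undirected. The order of a graph is its number of vertices, and $e(G)$ is its number of edges. $K_{s,t}$ denotes the complete bipartite graph with vertex classes of sizes $s$ and $t$. A graph is $K_{s,t}$-free if it does not contain $K_{s,t}$ as a (not necessarily induced) subgraph. *)

(* Defs.v *)
From mathcomp Require Import all_boot all_order all_algebra.

Set Implicit Arguments.
Unset Strict Implicit.
Unset Printing Implicit Defensive.

Record sgraph (T : finType) := SGraph {
  adj :> rel T;
  adj_sym : symmetric adj;
  adj_irr : irreflexive adj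
}.

Definition edges (T : finType) (G : sgraph T) : {set {set T}} :=
  [set [set p.1; p.2] | p : T * T & G p.1 p.2].

(* H is isomorphic to a not necessarily induced subgraph of G. *)
Definition contains (T U : finType) (G : sgraph T) (H : sgraph U) : Prop :=
  exists2 f : U -> T, injective f & {homo f : x y / H x y >-> G x y}.

Definition biclique_rel (s t : nat) : rel ('I_s + 'I_t) :=
  fun x y => match x, y with
             | inl _, inr _ | inr _, inl _ => true
             | _, _ => false
             end.

Lemma biclique_sym s t : symmetric (@biclique_rel s t).
Proof. by case=> x [] y. Qed.

Lemma biclique_irr s t : irreflexive (@biclique_rel s t).
Proof. by case=> x. Qed.

Definition biclique (s t : nat) : sgraph ('I_s + 'I_t)%type :=
  SGraph (@biclique_sym s t) (@biclique_irr s t).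

Definition biclique_free (s t : nat) (T : finType) (G : sgraph T) : Prop :=
  ~ contains G (biclique s t).

(* Main.v *)
Require Import Defs.
From mathcomp Require Import all_boot all_order all_algebra.
From mathcomp Require Import reals exp.
From mathcomp Require Import lra zify.
Import Order.TTheory GRing.Theory Num.Theory.
Local Open Scope ring_scope.

(** The number 2 e(G) counts the ones of the adjacency matrix, and this matrix
has no s x t all-ones submatrix, since the rows and the columns of such a
submatrix would be disjoint sets of vertices (the diagonal is zero) spanning a
biclique. So it suffices to bound the number e of ones in a 0/1 matrix with m
rows and n columns without a (q + k + 1) x t all-ones submatrix, q >= 1, by
  q^(1/t) n m^(1-1/t) + (t-1) m^(1+k/t) + k n,
and to put m = n, k = t - 2, q = s - t + 1 ([zarankiewicz_bound]).

The proof is by induction on k. For k = 0 it is the double counting of Kovari,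
Sos and Turan: a t-set of columns is contained in at most q rows, so
sum_x binom(d_x, t) <= q binom(n, t), where d_x is the number of ones in row x;
estimating binom(d, t) t! from below by (d - t + 1)^t and using the power mean
inequality gives the bound ([ones_leq_kst]).

For the step from k to k + 1, fix a row x and restrict the matrix to the other
rows and to the d_x columns where x has a one ([rect_free_setD1]): adding x to
the rows of an all-ones submatrix found there gives one more row, so the
induction hypothesis applies with k, the same q, and d_x columns. Summed over
all x, the numbers of ones of these restrictions (with x kept) give
sum_y D_y^2 where D_y are the column sums ([sum_ones_nbrs]), which is at least
e^2 / n by Cauchy-Schwarz. Hence e^2 / n <= a e + b with
a = q^(1/t) m^(1-1/t) + k + 1 and b = (t-1) m^(2+k/t). Since
e >= n m^(1-1/t) may be assumed, this yields e <= a n + (t-1) m^(1+(k+1)/t). *)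

Set Implicit Arguments.
Unset Strict Implicit.

(** * Power sums of natural numbers *)

Lemma leq_mul_exp_rearrange (a b k : nat) :
  (a * b ^ k + b * a ^ k <= a * a ^ k + b * b ^ k)%N.
Proof.
wlog le_ab : a b / (a <= b)%N => [H|].
  case/orP: (leq_total a b) => [|le_ba]; first exact: H.
  by rewrite addnC [leqRHS]addnC H.
have le_k : (a ^ k <= b ^ k)%N by case: k => [|k] //; rewrite leq_exp2r.
by move: (a ^ k)%N (b ^ k)%N le_k => c d; nia.
Qed.

(** Chebyshev's sum inequality for the similarly ordered sequences f and f^k:
twice the difference of the sides is a sum over pairs (i, j) of differences
that are nonnegative by [leq_mul_exp_rearrange]. *)
Lemma chebyshev_sum_exp (I : finType) (A : {set I}) (f : I -> nat) (k : nat) :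
  ((\sum_(i in A) f i) * (\sum_(i in A) f i ^ k)
     <= #|A| * \sum_(i in A) f i ^ k.+1)%N.
Proof.
rewrite -(leq_pmul2l (isT : (0 < 2)%N)) !mul2n -!addnn.
have prodE : ((\sum_(i in A) f i) * (\sum_(i in A) f i ^ k)
    = \sum_(i in A) \sum_(j in A) f i * f j ^ k)%N.
  by rewrite big_distrl; apply: eq_bigr => i _; rewrite big_distrr.
have cardE : (#|A| * \sum_(i in A) f i ^ k.+1
    = \sum_(i in A) \sum_(j in A) f i * f i ^ k)%N.
  rewrite big_distrr; apply: eq_bigr => i _.
  by rewrite sum_nat_const expnS.
rewrite {2}prodE exchange_big prodE cardE.
rewrite [X in (_ <= _ + X)%N]exchange_big -!big_split.
apply: leq_sum => i _; rewrite -!big_split.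
by apply: leq_sum => j _; apply: leq_mul_exp_rearrange.
Qed.

Lemma power_mean (I : finType) (A : {set I}) (f : I -> nat) (k : nat) :
  ((\sum_(i in A) f i) ^ k.+1 <= #|A| ^ k * \sum_(i in A) f i ^ k.+1)%N.
Proof.
elim: k => [|k IHk]; first by rewrite expn1 mul1n leq_sum.
rewrite expnS (leq_trans (leq_mul (leqnn _) IHk)) //.
rewrite mulnCA expnSr -mulnA leq_mul2l chebyshev_sum_exp orbT //.
Qed.

(** Each of the t + 1 factors d, ..., d - t of the falling factorial is at
least d - t; for d <= t the truncated left-hand side is 0. *)
Lemma exp_subn_leq_ffact (d t : nat) : ((d - t) ^ t.+1 <= d ^_ t.+1)%N.
Proof.
elim: t d => [|t IHt] d; first by rewrite subn0 expn1 ffactn1.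
case: d => [|d]; first by rewrite sub0n exp0n.
rewrite subSS ffactnS expnS; apply: leq_mul; last exact: IHt.
by rewrite (leq_trans (leq_subr _ _)).
Qed.

Lemma ffact_leq_exp (n t : nat) : (n ^_ t <= n ^ t)%N.
Proof.
elim: t n => [|t IHt] [|n] //.
rewrite ffactnS expnS leq_mul2l /=.
by rewrite (leq_trans (IHt n)) //; case: (t) => // u; rewrite leq_exp2r.
Qed.

(** * All-ones submatrices *)

Section Matrices.
Variables (A B : finType) (r : A -> B -> bool).
Implicit Types (x : A) (X : {set A}) (C : {set B}).

Definition nbrs (C : {set B}) (x : A) : {set B} := [set y in C | r x y].

Definition ones (X : {set A}) (C : {set B}) : nat :=
  \sum_(x in X) #|nbrs C x|.

(** Absence of an s x t all-ones submatrix with rows in X and columns in C. The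
conclusion is an upper bound on the number of rows, the form in which the
double counting uses it, instead of a ban on sets of exact sizes. *)
Definition rect_free (X : {set A}) (C : {set B}) (s t : nat) : Prop :=
  forall (S : {set A}) (U : {set B}), S \subset X -> U \subset C ->
    {in S & U, forall x y, r x y} -> (t <= #|U|)%N -> (#|S| < s)%N.

Lemma card_nbrsE C x : #|nbrs C x| = (\sum_(y in C) r x y)%N.
Proof.
rewrite -sum1_card big_mkcond [RHS]big_mkcond; apply: eq_bigr => y _.
by rewrite inE; case: (y \in C); case: (r x y).
Qed.

Lemma ones_colE X C :
  ones X C = (\sum_(y in C) #|[set x in X | r x y]|)%N.
Proof.
rewrite /ones; under eq_bigr do rewrite card_nbrsE.
rewrite exchange_big; apply: eq_bigr => y _.
rewrite -sum1_card big_mkcond [RHS]big_mkcond; apply: eq_bigr => x _.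
by rewrite inE; case: (x \in X); case: (r x y).
Qed.

(** Both sides count the triples (x, x', y) of two rows and a column such that
x and x' both have a one in column y. *)
Lemma sum_ones_nbrs X C :
  (\sum_(x in X) ones X (nbrs C x)
    = \sum_(y in C) #|[set x in X | r x y]| ^ 2)%N.
Proof.
under eq_bigr do rewrite ones_colE.
rewrite (exchange_big_dep (mem C)) => [|x y _]; last first.
  by rewrite inE => /andP[].
apply: eq_bigr => y; rewrite /= => yC.
rewrite -mulnn -sum_nat_const; apply: eq_bigl => x.
by rewrite !inE yC.
Qed.

Lemma ones_setD1 X C x :
  x \in X -> ones X (nbrs C x) = (#|nbrs C x| + ones (X :\ x) (nbrs C x))%N.
Proof.
move=> xX; rewrite /ones (big_setD1 x) //=; congr (_ + _)%N.
by apply: eq_card => y; rewrite !inE; case: (r x y); rewrite ?andbT ?andbF.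
Qed.

(** Row x is all ones on the columns [nbrs C x], so it extends every all-ones
submatrix on those columns by one row. *)
Lemma rect_free_setD1 X C s t x :
  x \in X -> rect_free X C s.+1 t -> rect_free (X :\ x) (nbrs C x) s t.
Proof.
move=> xX free S U; rewrite subsetD1 => /andP[sSX xS] /subsetP sU SU leU.
have := free (x |: S) U; rewrite cardsU1 xS; apply => //.
- by rewrite subUset sub1set xX.
- by apply/subsetP => y /sU; rewrite inE => /andP[].
- move=> z y; rewrite !inE => /orP[/eqP-> /sU|zS yU]; last exact: SU.
  by rewrite inE => /andP[].
Qed.

(** Double counting of the pairs (x, U) where U is a t-set of columns on which
row x is all ones: a given U occurs with at most s rows. *)
Lemma sum_bin_nbrs_leq X C s t :
  rect_free X C s.+1 t ->
  (\sum_(x in X) 'C(#|nbrs C x|, t) <= s * 'C(#|C|, t))%N.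
Proof.
move=> free.
pose tsets (D : {set B}) := [set U : {set B} | U \subset D & #|U| == t].
have binE (D : {set B}) : 'C(#|D|, t) = (\sum_(U in tsets D) 1)%N.
  by rewrite sum1_card cards_draws.
rewrite binE big_distrr; under eq_bigr do rewrite binE.
rewrite (exchange_big_dep (mem (tsets C))) /= => [|x U _]; last first.
  rewrite !inE => /andP[/subsetP sU ->]; rewrite andbT.
  by apply/subsetP => y /sU; rewrite inE => /andP[].
apply: leq_sum => U; rewrite inE muln1 => /andP[sUC /eqP cardU].
rewrite sum1dep_card -ltnS; apply: (free _ U) => //; last by rewrite cardU.
  by apply/subsetP => x; rewrite inE => /andP[].
move=> x y; rewrite !inE => /and3P[_ /subsetP sU _] /sU.
by rewrite inE => /andP[].
Qed.

Lemma sum_exp_nbrs_leq X C s t :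
  rect_free X C s.+1 t.+1 ->
  (\sum_(x in X) (#|nbrs C x| - t) ^ t.+1 <= s * #|C| ^ t.+1)%N.
Proof.
move=> free.
apply: (@leq_trans (\sum_(x in X) #|nbrs C x| ^_ t.+1)).
  by apply: leq_sum => x _; apply: exp_subn_leq_ffact.
under eq_bigr do rewrite -bin_ffact.
rewrite -big_distrl /=.
apply: (@leq_trans (s * #|C| ^_ t.+1)); last first.
  by rewrite leq_mul2l ffact_leq_exp orbT.
by rewrite -bin_ffact mulnA leq_mul2r sum_bin_nbrs_leq ?orbT.
Qed.

(** The number e is the sum of the truncated excesses of the row sums over t,
to which the power mean inequality applies. Stating the conclusion through e
keeps it within the natural numbers, free of (t + 1)-st roots. *)
Lemma ones_leq_kst X C s t :
  rect_free X C s.+1 t.+1 ->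
  exists2 e : nat, (ones X C <= e + t * #|X|)%N
    & (e ^ t.+1 <= #|X| ^ t * (s * #|C| ^ t.+1))%N.
Proof.
move=> free; exists (\sum_(x in X) (#|nbrs C x| - t))%N.
  rewrite mulnC -sum_nat_const -big_split leq_sum // => x _ /=.
  by rewrite addnC -leq_subLR.
apply: leq_trans (power_mean _ _ _) _.
by rewrite leq_mul2l sum_exp_nbrs_leq ?orbT.
Qed.

End Matrices.

Section Bound.
Variables (R : realDomainType) (A B : finType) (r : A -> B -> bool).

(** The reals al and mu stand for q^(1/(t+1)) and m^(1/(t+1)), where m is an
upper bound on the number of rows; with them the bound and its proof are
polynomial. Keeping m fixed while rows are deleted lets the same mu serve along
the whole induction. The condition al >= 1 is where q >= 1 enters: it makes the
first term at least n m^(1-1/(t+1)), the lower bound on e that the inductive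
step needs. *)
Lemma zarankiewicz_bound (k q t : nat) (al mu : R) (X : {set A}) (C : {set B}) :
  1 <= al -> 0 <= mu -> q%:R <= al ^+ t.+1 -> #|X|%:R <= mu ^+ t.+1 ->
  rect_free r X C (q + k).+1 t.+1 ->
  (ones r X C)%:R <=
    al * #|C|%:R * mu ^+ t + t%:R * mu ^+ (t.+1 + k) + k%:R * #|C|%:R.
Proof.
move=> al1 mu0 qal.
have al0 : 0 <= al by apply: le_trans al1.
elim: k X C => [|k IHk] X C Xmu.
  rewrite addn0 => /ones_leq_kst[e onesle ele].
  rewrite mul0r addr0 addn0.
  apply: (@le_trans _ _ (e + t * #|X|)%:R); first by rewrite ler_nat.
  rewrite natrD natrM lerD ?ler_wpM2l //.
  rewrite -(@ler_pXn2r _ t.+1) ?nnegrE ?mulr_ge0 ?exprn_ge0 //.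
  apply: (@le_trans _ _ (#|X| ^ t * (q * #|C| ^ t.+1))%:R).
    by rewrite -natrX ler_nat.
  rewrite !natrM !natrX !exprMn -exprM mulnC exprM mulrC.
  apply: ler_pM; rewrite ?mulr_ge0 ?exprn_ge0 //.
    by rewrite ler_wpM2r ?exprn_ge0.
  by rewrite lerXn2r ?nnegrE ?exprn_ge0.
rewrite addnS => free.
set e := (ones r X C)%:R; set n := #|C|%:R.
have n0 : 0 <= n by [].
have e0 : 0 <= e by [].
(* The induction hypothesis for the restriction to the ones of row x, with
   row x itself counted again; this row accounts for k growing by one. *)
have row x : x \in X -> (ones r X (nbrs r C x))%:R <=
    (al * mu ^+ t + k.+1%:R) * #|nbrs r C x|%:R + t%:R * mu ^+ (t.+1 + k).
  move=> xX; rewrite ones_setD1 // natrD.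
  have := IHk (X :\ x) (nbrs r C x).
  move/(_ _ (rect_free_setD1 xX free)).
  have -> : #|X :\ x|%:R <= mu ^+ t.+1.
    by apply: le_trans Xmu; rewrite ler_nat subset_leq_card ?subD1set.
  by move/(_ isT); rewrite -[k.+1]addn1 natrD; lra.
have total : (\sum_(x in X) ones r X (nbrs r C x))%:R <=
    (al * mu ^+ t + k.+1%:R) * e + mu ^+ t.+1 * (t%:R * mu ^+ (t.+1 + k)).
  rewrite natr_sum; apply: le_trans (ler_sum _ row) _.
  rewrite big_split /= -mulr_sumr -natr_sum lerD2l sumr_const -[leLHS]mulr_natl.
  by rewrite ler_wpM2r ?mulr_ge0 ?exprn_ge0.
have cauchy : e ^+ 2 <= n * (\sum_(x in X) ones r X (nbrs r C x))%:R.
  by rewrite sum_ones_nbrs /e ones_colE -natrX -natrM ler_nat power_mean.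
(* If e exceeded the bound n a + z mu, where a e + w mu z bounds the sum in
   total, then e^2 > n a e + z mu e >= n (a e + z mu w), as e >= n w. This
   contradicts cauchy and total. *)
rewrite leNgt; apply/negP => lt_e.
set w := mu ^+ t in total lt_e *; set z := t%:R * mu ^+ (t.+1 + k) in total.
have zE : t%:R * mu ^+ (t.+1 + k.+1) = z * mu by rewrite addnS exprSr mulrA.
have muw : mu ^+ t.+1 = w * mu by rewrite exprSr.
rewrite zE in lt_e; rewrite muw in total.
have w0 : 0 <= w by rewrite exprn_ge0.
have zmu0 : 0 <= z * mu by rewrite !mulr_ge0 ?exprn_ge0.
have nwe : n * w <= e.
  apply: le_trans (ltW lt_e).
  have : n * w <= al * n * w by rewrite -mulrA ler_peMl ?mulr_ge0.
  have : 0 <= k.+1%:R * n by rewrite mulr_ge0.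
  lra.
have e_gt0 : 0 < e.
  by apply: le_lt_trans lt_e; rewrite ?addr_ge0 ?zmu0 ?mulr_ge0.
have : e * (al * n * w + z * mu + k.+1%:R * n) < e ^+ 2.
  by rewrite expr2 ltr_pM2l.
have := ler_wpM2l n0 total.
have := ler_wpM2r zmu0 nwe.
lra.
Qed.

End Bound.

(** * Graphs *)

(** The pairs (x, y) and (y, x) give the same edge and are distinct because
the graph has no loops, so each fibre of the map from adjacent pairs to edges
has at least two elements. *)
Lemma double_card_edges (T : finType) (G : sgraph T) :
  (2 * #|edges G| <= ones G [set: T] [set: T])%N.
Proof.
pose P := [set p : T * T | G p.1 p.2].
have -> : ones G [set: T] [set: T] = (\sum_(p in P) 1)%N.
  rewrite /ones; under eq_bigr do rewrite -sum1_card.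
  rewrite pair_big_dep; apply: eq_bigl => -[x y].
  by rewrite !inE.
rewrite (partition_big_imset (fun p : T * T => [set p.1; p.2])) /=.
rewrite mulnC -sum_nat_const; apply: leq_sum => _ /imsetP[[x y] + ->].
rewrite inE /= => Gxy.
have xy : x != y by apply: contraTneq Gxy => ->; rewrite adj_irr.
rewrite sum1dep_card (@leq_trans #|[set (x, y); (y, x)]|) //.
  by rewrite cards2 xpair_eqE negb_and xy.
apply/subset_leq_card/subsetP => p; rewrite !inE.
case/orP => /eqP->; rewrite /= ?Gxy ?eqxx //.
by rewrite adj_sym Gxy setUC eqxx.
Qed.

(** The vertex classes S and U of an all-ones submatrix of the adjacency matrix
are automatically disjoint, since no vertex is adjacent to itself; this makes
the embedding of the biclique injective. *)
Lemma biclique_free_rect_free (T : finType) (G : sgraph T) (s t : nat) :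
  biclique_free s t G -> rect_free G [set: T] [set: T] s t.
Proof.
move=> free S U _ _ SU leU; rewrite ltnNge; apply/negP => leS; apply: free.
pose fS i := enum_val (widen_ord leS i).
pose fU i := enum_val (widen_ord leU i).
have SUf i j : G (fS i) (fU j) by apply: SU; apply: enum_valP.
have neq i j : fS i != fU j.
  by apply: contraTneq (SUf i j) => ->; rewrite adj_irr.
exists (fun u => match u with inl i => fS i | inr j => fU j end).
  move=> [i|j] [i'|j'] /= E.
  - by congr inl; apply/val_inj/(congr1 val (enum_val_inj E)).
  - by move: (neq i j'); rewrite E eqxx.
  - by move: (neq i' j); rewrite E eqxx.
  - by congr inr; apply/val_inj/(congr1 val (enum_val_inj E)).
by move=> [i|j] [i'|j'] //= _; rewrite adj_sym.
Qed.

Unset Implicit Arguments.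

Theorem mainTheorem3 (R : realType) (s t n : nat) (T : finType)
    (G : sgraph T) (ht : (2 <= t)%N) (hst : (t <= s)%N) (hn : #|T| = n)
    (hfree : biclique_free s t G) :
  #|edges G|%:R <=
    1 / 2 * (s%:R - t%:R + 1) `^ (1 / t%:R) * n%:R `^ (2 - 1 / t%:R)
    + 1 / 2 * (t%:R - 1) * n%:R `^ (2 - 2 / t%:R)
    + 1 / 2 * (t%:R - 2) * n%:R :> R.
Proof.
have := zarankiewicz_bound (R := R) (r := G) (k := t - 2) (q := (s - t).+1)
  (t := t.-1).
have -> : t.-1.+1 = t by lia.
have t0 : t%:R != 0 :> R by rewrite pnatr_eq0; lia.
have rootK (x : R) : 0 <= x -> (x `^ (1 / t%:R)) ^+ t = x.
  by move=> x0; rewrite -powR_mulrn ?powR_ge0 // -powRrM divfK // powRr1.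
have sE : s%:R - t%:R + 1 = (s - t).+1%:R :> R.
  by rewrite -natrB // -[(s - t).+1]addn1 natrD.
rewrite sE.
set al := (s - t).+1%:R `^ (1 / t%:R); pose mu : R := n%:R `^ (1 / t%:R).
move=> /(_ al mu [set: T] [set: T]).
rewrite !rootK // cardsT hn.
have -> : ((s - t).+1 + (t - 2)).+1 = s by lia.
have al1 : 1 <= al.
  rewrite -[leLHS](powRr0 (s - t).+1%:R) ler_powR ?ler1n //.
  by rewrite divr_ge0.
have mu0 : 0 <= mu by apply: powR_ge0.
move=> /(_ al1 mu0 (lexx _) (lexx _) (biclique_free_rect_free hfree)).
have powE (j : nat) : (j <= t.*2)%N -> (0 < n)%N ->
    n%:R `^ (2 - j%:R / t%:R) = mu ^+ (t.*2 - j).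
  move=> j2t n0; rewrite -powR_mulrn ?powR_ge0 // -powRrM; congr (_ `^ _).
  rewrite natrB // -muln2 natrM mulrBr mul1r [_^-1 * (t%:R * _)]mulrA.
  by rewrite mulVf // mul1r [_^-1 * _]mulrC.
have muK : mu ^+ t = n%:R by apply: rootK.
have -> : t.-1%:R = t%:R - 1 :> R by rewrite -subn1 natrB //; lia.
rewrite (natrB _ ht) => bound.
have := double_card_edges G; rewrite -(ler_nat R) natrM => handshake.
(* For n = 0 the rules for real powers of n fail, but then the bound on the
   number of ones is 0 and the right-hand side is nonnegative. *)
have [n0|n0] := posnP n.
  move: bound; rewrite exprD muK n0 mulr0 !mul0r mulr0 !addr0 => bound.
  apply: (@le_trans _ _ 0); first by lra.
  have t1 : 0 <= t%:R - 1 :> R by rewrite subr_ge0 ler1n ltnW.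
  rewrite mulr0 addr0.
  by rewrite addr_ge0 // !mulr_ge0 ?powR_ge0 ?invr_ge0.
rewrite (powE 1%N) ?(powE 2%N) //; try lia.
have -> : (t.*2 - 1 = t + t.-1)%N by lia.
have -> : (t.*2 - 2 = t + (t - 2))%N by lia.
rewrite [mu ^+ (t + t.-1)]exprD muK; lra.
Qed.
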